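(* Let $s,t\ge 3$ be integers, let $d\in\{1,2,\dots,t\}$, let $\varphi$ be the cyclic $d$-shift of $C_t$, and let $G=C_s\Box^{\varphi}C_t$. Then $mbt(G)=4$ if $G$ is bipartite, and $mbt(G)=5$ otherwise.
   Context: The cycle $C_t$ has vertex set $\{1,\dots,t\}$ with $j$ adjacent to $j\pm 1$ (mod $t$). The cyclic $d$-shift of $C_t$ is the automorphism $j\mapsto j+d \pmod t$ (it is nontrivial if $d\not\equiv 0\pmod t$). For an automorphism $\varphi$ of $C_t$, the Cartesian graph bundle $C_s\Box^{\varphi}C_t$ (fiber $C_t$ over base $C_s$, with $\varphi$ assigned to the base edge $\{s,1\}$ and the identity to all other base edges) is the graph with vertex set $\{(i,j):1\le i\le s,\ 1\le j\le t\}$ and edges: $(i,j)\sim(i,j+1)$ (second coordinate mod $t$) for all $i,j$; $(i,j)\sim(i+1,j)$ for $1\le i\le s-1$ and all $j$; and $(s,j)\sim(1,\varphi(j))$ for all $j$. A matching book embedding of a graph $G$ with $m$ pages consists of an arrangement of the vertices of $G$ in some cyclic order on a circle, with edges drawn as chords, together with a proper edge coloring with $m$ colors such that any two edges whose chords cross receive different colors. The matching book thickness $mbt(G)$ is the minimum $m$ for which such an embedding exists. $G$ is called dispersable if $mbt(G)=\Delta(G)$ and nearly dispersable if $mbt(G)=\Delta(G)+1$. *)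

(* Defs.v *)
From mathcomp Require Import all_boot.

Set Implicit Arguments.
Unset Strict Implicit.
Unset Printing Implicit Defensive.

Definition bipartite (V : finType) (e : rel V) : Prop :=
  exists A : {set V}, forall x y, e x y -> (x \in A) != (y \in A).

Definition edges (V : finType) (e : rel V) : {set {set V}} :=
  [set [set x.1; x.2] | x : V * V & e x.1 x.2].

Definition edge (V : finType) (e : rel V) : finType :=
  {E : {set V} | E \in edges e}.

(* The circle is cut open just before position 0, so that cyclic orders become
   numberings p of the vertices.  Two chords cross iff their ends alternate
   along the circle; cut open, this means that the four ends, read by
   increasing position, belong to E, F, E, F or to F, E, F, E.  Chords with a
   common end do not cross, because of the strict inequalities. *)
Definition alternate (V : finType) (n : nat) (p : V -> 'I_n) (E F : {set V})
    : bool :=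
  [exists a in E, exists b in F, exists a' in E, exists b' in F,
    [&& p a < p b, p b < p a' & p a' < p b']].

Definition cross (V : finType) (n : nat) (p : V -> 'I_n) (E F : {set V})
    : bool :=
  alternate p E F || alternate p F E.

Definition proper_coloring (V : finType) (e : rel V) (C : eqType)
    (c : edge e -> C) : bool :=
  [forall E : edge e, forall F : edge e,
    (E != F) && (val E :&: val F != set0) ==> (c E != c F)].

Definition matching_book_embedding (V : finType) (e : rel V) (m : nat)
    (p : V -> 'I_#|V|) (c : edge e -> 'I_m) : bool :=
  [&& injectiveb p, proper_coloring c &
    [forall E : edge e, forall F : edge e,
      cross p (val E) (val F) ==> (c E != c F)]].

Definition embeddable (V : finType) (e : rel V) (m : nat) : bool :=
  [exists p : {ffun V -> 'I_#|V|}, exists c : {ffun edge e -> 'I_m},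
    matching_book_embedding p c].

Lemma cross_irrefl (V : finType) (e : rel V) n (p : V -> 'I_n) (E : edge e) :
  cross p (val E) (val E) = false.
Proof.
case: E => E /= /imsetP[[x y] _ ->] /=; rewrite /cross orbb /alternate.
apply/negbTE/negP => /exists_inP[a aE /exists_inP[b bE /exists_inP[a' a'E]]].
case/exists_inP=> b' _; move: aE bE a'E; rewrite !inE.
by do 3![case/orP => /eqP->]; case/and3P; rewrite ?ltnn // => h1 h2 _;
  have := ltn_trans h1 h2; rewrite ltnn.
Qed.

Lemma ex_embeddable (V : finType) (e : rel V) : exists m, embeddable e m.
Proof.
exists #|edge e|; apply/existsP; exists [ffun x => enum_rank x].
apply/existsP; exists [ffun E => enum_rank E]; apply/and3P; split.
- by apply/injectiveP => x y; rewrite !ffunE => /enum_rank_inj.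
- apply/forallP => E; apply/forallP => F; apply/implyP => /andP[neEF _].
  by rewrite !ffunE (inj_eq enum_rank_inj).
- apply/forallP => E; apply/forallP => F; apply/implyP => crEF.
  rewrite !ffunE (inj_eq enum_rank_inj); apply: contraTneq crEF => ->.
  by rewrite cross_irrefl.
Qed.

Definition mbt (V : finType) (e : rel V) : nat := ex_minn (ex_embeddable e).

(* Vertices are numbered from 0: the cycle C_t lives on 'I_t, and [ordS] is
   the successor modulo t. *)
Definition cycle_graph (t : nat) : rel 'I_t :=
  [rel j k | (k == ordS j) || (j == ordS k)].

Lemma shift_subproof (t d : nat) (j : 'I_t) : (j + d) %% t < t.
Proof. by rewrite ltn_pmod // (leq_ltn_trans (leq0n j) (ltn_ord j)). Qed.

Definition shift (t d : nat) (j : 'I_t) : 'I_t := Ordinal (shift_subproof d j).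

(* The last disjunct is the twisted base edge {s, 1} (here from s - 1 to 0),
   traversed from its first end to its second. *)
Definition bundle_arc (s t : nat) (phi : 'I_t -> 'I_t) : rel ('I_s * 'I_t) :=
  [rel u v : 'I_s * 'I_t |
    [|| (u.1 == v.1) && cycle_graph u.2 v.2,
        (v.1 == u.1.+1 :> nat) && (v.2 == u.2)
      | [&& u.1.+1 == s, v.1 == 0 :> nat & v.2 == phi u.2]]].

Definition bundle (s t : nat) (phi : 'I_t -> 'I_t) : rel ('I_s * 'I_t) :=
  [rel u v | bundle_arc phi u v || bundle_arc phi v u].

Lemma shift_inj (t d : nat) : injective (@shift t d).
Proof.
move=> j k /(congr1 val) /= /eqP; rewrite eqn_modDr !modn_small // => /eqP.
exact: val_inj.
Qed.

Lemma cycle_graph_shift (t d : nat) (j k : 'I_t) :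
  cycle_graph (shift d j) (shift d k) = cycle_graph j k.
Proof.
have shiftS i : ordS (shift d i) = shift d (ordS i).
  by apply: val_inj; rewrite /= modnDml -addn1 modnDml addn1 addSn.
by rewrite /cycle_graph /= !shiftS !(inj_eq (@shift_inj t d)).
Qed.

Lemma bundle_sym (s t : nat) (phi : 'I_t -> 'I_t) : symmetric (@bundle s t phi).
Proof. by move=> u v; rewrite /bundle /= orbC. Qed.

Lemma bundle_irrefl (s t : nat) (phi : 'I_t -> 'I_t) :
  1 < s -> 1 < t -> irreflexive (@bundle s t phi).
Proof.
move=> s1 t1 [i j]; rewrite /bundle /bundle_arc /cycle_graph /= !orbb eqxx /=.
have /negbTE-> : j != ordS j.
  apply/eqP => /(congr1 val) /=; have := ltn_ord j.
  rewrite leq_eqVlt => /predU1P[jt|jt]; last by rewrite modn_small // => /n_Sn.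
  by rewrite [X in _ = X %% _]jt modnn => j0; move: t1; rewrite -[X in 1 < X]jt j0.
have /negbTE-> : i != i.+1 :> nat by rewrite neq_ltn ltnSn.
by apply/negbTE/and3P => -[/eqP i_s /eqP i0 _]; move: s1; rewrite -[s]i_s i0.
Qed.

(* Main.v *)
Require Import Defs.
From mathcomp Require Import all_boot zify.

(* Upper bounds come from explicit embeddings.  For s and t even the vertices
   are listed row by row in boustrophedon order, so that the edges joining two
   consecutive rows are nested; variants of this order, and for s odd, t even
   and d odd a similar order by columns, handle the other parities.  The
   reflection j -> -j exchanges the d-shift and the (t - d)-shift.
   Lower bounds: the graph is 4-regular, so at least 4 colors are needed, and if
   4 suffice each color class is a perfect matching.  For an edge xy of color k,
   the vertices strictly between x and y are then matched among themselves by
   color k, so their number is even and the positions of x and y have opposite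
   parities: the graph is bipartite. *)

Set Implicit Arguments.
Unset Strict Implicit.
Unset Printing Implicit Defensive.

(** * Numbering vertices by lexicographic keys *)

Definition lexlt (x y : nat * nat) : bool :=
  (x.1 < y.1) || (x.1 == y.1) && (x.2 < y.2).

Lemma lexlt_trans : transitive lexlt.
Proof. by move=> [a b] [c d] [e f]; rewrite /lexlt /=; lia. Qed.

Lemma lexlt_irr x : lexlt x x = false.
Proof. by case: x => a b; rewrite /lexlt /=; lia. Qed.

Lemma lexlt_total x y : x != y -> lexlt x y || lexlt y x.
Proof. by case: x y => [a b] [c d]; rewrite /lexlt xpair_eqE /=; lia. Qed.

Section Rank.

Variables (V : finType) (K : V -> nat * nat).
Hypothesis K_inj : injective K.

(** Counting smaller keys turns any injective key into a numbering by ['I_#|V|], so explicit orders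
    may leave gaps between keys. *)
Definition below v := #|[set u | lexlt (K u) (K v)]|.

Lemma below_lt v : below v < #|V|.
Proof.
rewrite -cardsT; apply: proper_card; rewrite properE subsetT /=.
by apply/subsetPn; exists v; rewrite ?inE // lexlt_irr.
Qed.

Definition rank v : 'I_#|V| := Ordinal (below_lt v).

Lemma rank_lt u v : (rank u < rank v) = lexlt (K u) (K v).
Proof.
have mono x y : lexlt (K x) (K y) -> below x < below y.
  move=> xy; apply: proper_card; rewrite properE; apply/andP; split.
    by apply/subsetP => z; rewrite !inE => /lexlt_trans; apply.
  by apply/subsetPn; exists x; rewrite !inE ?lexlt_irr.
apply/idP/idP => [/= uv|]; last exact: mono.
have [uv'|] := eqVneq (K u) (K v); first by rewrite (K_inj uv') ltnn in uv.
case/lexlt_total/orP => // /mono; lia.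
Qed.

Lemma rank_inj : injective rank.
Proof.
move=> u v uv; apply: K_inj; apply/eqP/negPn/negP => /lexlt_total.
by rewrite -!rank_lt uv ltnn.
Qed.

End Rank.

(** * Embeddings from colored arcs *)

Definition lexneq (x y : nat * nat) : bool := (x.1 != y.1) || (x.2 != y.2).

Lemma lexneqE x y : lexneq x y = (x != y).
Proof. by case: x y => [a b] [c d]; rewrite xpair_eqE negb_and. Qed.

(* The patterns with [k3] or [k4] first are excluded by the instance of [apart]
   with the two chords exchanged. *)
Definition apart (k1 k2 k3 k4 : nat * nat) : bool :=
  [&& lexneq k1 k3, lexneq k1 k4, lexneq k2 k3, lexneq k2 k4,
      ~~ [&& lexlt k1 k3, lexlt k3 k2 & lexlt k2 k4],
      ~~ [&& lexlt k2 k3, lexlt k3 k1 & lexlt k1 k4],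
      ~~ [&& lexlt k1 k4, lexlt k4 k2 & lexlt k2 k3]
    & ~~ [&& lexlt k2 k4, lexlt k4 k1 & lexlt k1 k3]].

Section Arcs.

Variables (V A : finType) (e : rel V) (src tgt : A -> V) (m : nat).
Variables (K : V -> nat * nat) (c : A -> 'I_m).
Hypothesis arcs_cover :
  forall x y, e x y -> exists a, [set x; y] = [set src a; tgt a].
Hypothesis K_inj : injective K.
Hypothesis c_apart : forall a b, c a = c b ->
  a = b \/ apart (K (src a)) (K (tgt a)) (K (src b)) (K (tgt b)).

Lemma edge_arc (E : edge e) : exists a, val E == [set src a; tgt a].
Proof.
case: E => E /= /imsetP[[x y]]; rewrite inE /= => /arcs_cover[a xy] ->.
by exists a; apply/eqP.
Qed.

(** Each edge takes the color of one chosen arc with the same ends. Different edges have different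
    chosen arcs, so [c_apart] keeps equally colored edges disjoint and uncrossed. *)
Lemma embeddable_of_arcs : embeddable e m.
Proof.
pose arc E := xchoose (edge_arc E).
have arcE E : val E = [set src (arc E); tgt (arc E)].
  exact/eqP/(xchooseP (edge_arc E)).
pose p := [ffun v => rank K v].
apply/existsP; exists p; apply/existsP; exists [ffun E => c (arc E)].
have ap E F : E != F -> c (arc E) = c (arc F) ->
    apart (K (src (arc E))) (K (tgt (arc E)))
          (K (src (arc F))) (K (tgt (arc F))).
  move=> neEF /c_apart[eqEF|//]; case/eqP: neEF; apply: val_inj.
  by rewrite !arcE eqEF.
have alt E F : E != F -> c (arc E) = c (arc F) ->
    ~~ alternate p (val E) (val F).
  move=> neEF /(ap E F neEF) /and5P[_ _ _ _ /and4P[x1 x2 x3 x4]].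
  apply/negP => /exists_inP[a aE /exists_inP[b bF]].
  case/exists_inP=> a' aE' /exists_inP[b' bF'].
  rewrite !ffunE !(rank_lt K_inj) => abab; case/and3P: (abab) => ab ba' ab'.
  (* Alternation makes [a], [a'] the two ends of one chord and [b], [b'] those of the other; the
     four possible assignments are the four negated clauses of [apart]. *)
  have aa' : a != a'.
    by apply: contraTneq (lexlt_trans ab ba') => ->; rewrite lexlt_irr.
  have bb' : b != b'.
    by apply: contraTneq (lexlt_trans ba' ab') => ->; rewrite lexlt_irr.
  move: aE aE' bF bF'; rewrite !arcE !inE.
  by do 4![case/orP => /eqP ?]; subst; move: aa' bb' x1 x2 x3 x4;
    rewrite ?eqxx ?abab.
apply/and3P; split.
- by apply/injectiveP => u v; rewrite !ffunE => /(rank_inj K_inj).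
- apply/forallP => E; apply/forallP => F; apply/implyP => /andP[neEF].
  case/set0Pn => x; rewrite inE !arcE !inE !ffunE.
  apply: contraL => /eqP /(ap E F neEF).
  rewrite /apart !lexneqE => /and5P[n1 n2 n3 n4 _]; rewrite negb_and !negb_or.
  case: (x =P src (arc E)) => [->|_] /=.
    by rewrite -!(inj_eq K_inj) n1 n2.
  by case: (x =P tgt (arc E)) => [->|//]; rewrite -!(inj_eq K_inj) n3 n4.
- apply/forallP => E; apply/forallP => F; apply/implyP => crEF; rewrite !ffunE.
  have [eqEF|neEF] := eqVneq E F; first by rewrite eqEF cross_irrefl in crEF.
  apply: contraL crEF => /eqP cEF; rewrite negb_or alt //=.
  by apply: alt; rewrite 1?eq_sym.
Qed.

End Arcs.

(** * Lower bound: color classes as perfect matchings *)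

Lemma alternateI (V : finType) n (p : V -> 'I_n) (E F : {set V}) a b a' b' :
  a \in E -> b \in F -> a' \in E -> b' \in F ->
  p a < p b -> p b < p a' -> p a' < p b' -> alternate p E F.
Proof.
move=> aE bF a'E b'F ab ba' ab'.
apply/exists_inP; exists a => //; apply/exists_inP; exists b => //.
apply/exists_inP; exists a' => //; apply/exists_inP; exists b' => //.
by rewrite ab ba' ab'.
Qed.

Section LowerBound.

Variables (V : finType) (e : rel V) (m : nat).
Hypotheses (e_sym : symmetric e) (e_irr : irreflexive e).
Variables (p : V -> 'I_#|V|) (c : edge e -> 'I_m).
Hypothesis emb : matching_book_embedding p c.

(** Colors are read off pairs of vertices, with [None] off the edges, so that no membership proof
    has to be carried. *)
Definition color (x y : V) : option 'I_m :=
  omap c (insub [set x; y] : option (edge e)).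

Lemma colorC x y : color x y = color y x.
Proof. by rewrite /color setUC. Qed.

Lemma colorE x y : e x y ->
  {E : edge e | val E = [set x; y] & color x y = Some (c E)}.
Proof.
move=> xy; have xyE : [set x; y] \in edges e.
  by apply/imsetP; exists (x, y); rewrite ?inE.
by exists (Sub [set x; y] xyE); rewrite ?SubK // /color insubT.
Qed.

Lemma color_neq x y z w : e x y -> e z w -> [set x; y] != [set z; w] ->
  ([set x; y] :&: [set z; w] != set0) || cross p [set x; y] [set z; w] ->
  color x y != color z w.
Proof.
case/and3P: emb => _ prop cr.
move=> /colorE[E <- ->] /colorE[F <- ->]; rewrite (inj_eq val_inj) => EF.
case/orP => [meet | crEF]; rewrite (inj_eq Some_inj).
  by have /forallP/(_ F)/implyP := forallP prop E; rewrite EF meet; apply.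
by have /forallP/(_ F)/implyP := forallP cr E; apply.
Qed.

Lemma color_inj x : {in [pred y | e x y] &, injective (color x)}.
Proof.
move=> y z; rewrite !inE => xy xz; apply: contra_eq => yz.
apply: color_neq => //.
  apply: contra_neq yz => /setP/(_ y); rewrite !inE eqxx orbT.
  case/esym/orP => /eqP // yx.
  by rewrite yx e_irr in xy.
by apply/orP; left; apply/set0Pn; exists x; rewrite !inE eqxx.
Qed.

Lemma color_neighbours x :
  {subset [seq color x y | y in e x] <= image (@Some 'I_m) predT}.
Proof. by move=> _ /imageP[y /colorE[E _ ->] ->]; apply: image_f. Qed.

Lemma degree_le x : #|e x| <= m.
Proof.
rewrite -(card_in_image (@color_inj x)) -[X in _ <= X]card_ord.
rewrite -[X in _ <= X](card_image (@Some_inj _)).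
apply: subset_leq_card; apply/subsetP; exact: color_neighbours.
Qed.

Hypothesis regular : forall x, #|e x| = m.

(** The [m] edges at [x] have pairwise different colors out of [m], so every color occurs. *)
Lemma mate_exists x k : exists2 y, e x y & color x y = Some k.
Proof.
have : [seq color x y | y in e x] =i image (@Some 'I_m) predT.
  apply/subset_cardP; last by apply/subsetP; exact: color_neighbours.
  rewrite (card_in_image (@color_inj x)) (card_image (@Some_inj _)) card_ord.
  exact: regular.
by move/(_ (Some k)); rewrite image_f // => /imageP[y xy ->]; exists y.
Qed.

Lemma mate_uniq x y z k :
  e x y -> e x z -> color x y = Some k -> color x z = Some k -> y = z.
Proof. by move=> xy xz cy cz; apply: (@color_inj x); rewrite ?inE ?cy. Qed.

(** As [p] is a bijection, this is the value of [p x]; written as a cardinality, it splits along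
    disjoint sets. *)
Definition position x := #|[set z | p z < p x]|.

Lemma position_parity_lt x y :
  e x y -> p x < p y -> odd (position x) != odd (position y).
Proof.
move=> xy lt_xy; have [E _ ck] := colorE xy; set k := c E in ck.
have mateP z : exists w, e z w && (color z w == Some k).
  by have [w zw cw] := mate_exists z k; exists w; rewrite zw cw eqxx.
(* [f] is the perfect matching formed by the edges of color [k]. *)
pose f z := xchoose (mateP z).
have ef z : e z (f z) by have /andP[] := xchooseP (mateP z).
have cf z : color z (f z) = Some k by have /andP[_ /eqP] := xchooseP (mateP z).
have fE z w : e z w -> color z w = Some k -> f z = w.
  by move=> zw cw; apply: (mate_uniq (ef z) zw (cf z) cw).
have fK : involutive f by move=> z; apply: fE; rewrite 1?e_sym 1?colorC.
have fx : f x = y by exact: fE.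
have p_inj : injective p by case/and3P: emb => /injectiveP.
pose B := [set z | p x < p z < p y].
(* If [f z] lay outside the interval, the chord from [z] to [f z] would cross the chord [xy] of the
   same color. *)
have fB z : z \in B -> f z \in B.
  rewrite !inE => /andP[xz zy]; apply/negPn/negP => nB.
  have zx : z != x by apply: contraTneq xz => ->; rewrite ltnn.
  have zny : z != y by apply: contraTneq zy => ->; rewrite ltnn.
  have fzx : f z != x by rewrite -(can_eq fK) fK fx.
  have fzy : f z != y by rewrite -fx (can_eq fK).
  have : color x y = color z (f z) by rewrite ck cf.
  apply/eqP; apply: color_neq => //.
    apply: contra_neq zx => /setP/(_ z).
    by rewrite !inE eqxx (negPf zny) orbF => /eqP.
  rewrite orbC; apply/orP; left.
  have nx : p (f z) != p x :> nat by rewrite (inj_eq val_inj) (inj_eq p_inj).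
  have ny : p (f z) != p y :> nat by rewrite (inj_eq val_inj) (inj_eq p_inj).
  have [lt_fx | ] := ltnP (p (f z)) (p x).
    apply/orP; right.
    by apply: (@alternateI _ _ _ _ _ (f z) x z y); rewrite ?inE ?eqxx ?orbT.
  move=> le_fx; apply/orP; left.
  apply: (@alternateI _ _ _ _ _ x z y (f z)); rewrite ?inE ?eqxx ?orbT //.
  lia.
have evenB : ~~ odd #|B|.
  (* [B] consists of the lower ends of its matching edges and their images under [f], in equal
     number. *)
  pose B1 := [set z in B | p z < p (f z)].
  have -> : #|B| = #|B1| + #|f @: B1|.
    rewrite -(cardsID [set z | p z < p (f z)]) -setIdE; congr (_ + _).
    apply: eq_card => z; rewrite -{2}[z]fK (mem_imset _ _ (can_inj fK)) !inE fK.
    have : p (f z) != p z :> nat.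
      rewrite (inj_eq val_inj) (inj_eq p_inj).
      by apply: contraTneq (ef z) => ->; rewrite e_irr.
    have := fB z; have := fB (f z); rewrite fK !inE; lia.
  by rewrite (card_imset _ (can_inj fK)) addnn odd_double.
have -> : position y = position x + (1 + #|B|).
  rewrite -(cards1 x) -cardsUI (_ : _ :&: _ = set0) ?cards0 ?addn0; last first.
    apply/setP => z; rewrite !inE; apply/negP => /andP[/eqP ->].
    by rewrite ltnn.
  rewrite -cardsUI (_ : _ :&: _ = set0) ?cards0 ?addn0; last first.
    apply/setP => z; rewrite !inE; apply/negP => /andP[zx /predU1P[zx' |]].
      by rewrite zx' ltnn in zx.
    lia.
  apply: eq_card => z; rewrite !inE.
  have -> : (z == x) = (p z == p x :> nat).
    by rewrite (inj_eq val_inj) (inj_eq p_inj).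
  lia.
by rewrite oddD oddD (negPf evenB); case: odd.
Qed.

Lemma perfect_bipartite : bipartite e.
Proof.
exists [set x | odd (position x)] => x y xy; rewrite !inE.
have p_inj : injective p by case/and3P: emb => /injectiveP.
have [lt|lt|/val_inj/p_inj eq_xy] := ltngtP (p x) (p y).
- exact: position_parity_lt.
- by rewrite eq_sym; apply: position_parity_lt; rewrite 1?e_sym.
- by rewrite eq_xy e_irr in xy.
Qed.

End LowerBound.

(** * Neighbours and degree in the bundle *)

Lemma modn_succ n i : i < n -> i.+1 %% n = if i.+1 < n then i.+1 else 0.
Proof.
move=> lt_in; case: ltnP => [/modn_small //|ni].
by have -> : i.+1 = n by [lia]; rewrite modnn.
Qed.

Lemma val_ordS n (i : 'I_n) : ordS i = (if i.+1 < n then i.+1 else 0) :> nat.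
Proof. exact: modn_succ. Qed.

Section BundleArcs.

Variables (s t : nat) (phi : 'I_t -> 'I_t).
Hypothesis phi_inj : injective phi.
Implicit Types u v : 'I_s * 'I_t.

Definition fiber_next u : 'I_s * 'I_t := (u.1, ordS u.2).

Definition base_next u : 'I_s * 'I_t :=
  (ordS u.1, if u.1.+1 < s then u.2 else phi u.2).

Lemma ordS_inj n : injective (@ordS n).
Proof. exact: can_inj (@ordSK n). Qed.

Lemma fiber_next_inj : injective fiber_next.
Proof.
move=> [i j] [i' j'] /eqP; rewrite xpair_eqE (inj_eq (@ordS_inj _)) /=.
by case/andP=> /eqP-> /eqP->.
Qed.

Lemma base_next_inj : injective base_next.
Proof.
move=> [i j] [i' j'] /eqP; rewrite xpair_eqE (inj_eq (@ordS_inj _)) /=.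
case/andP=> /eqP->.
by case: ifP => _ /eqP => [|/phi_inj] ->.
Qed.

Lemma bundle_arcE u v : bundle_arc phi u v =
  [|| v == fiber_next u, u == fiber_next v | v == base_next u].
Proof.
case: u v => [i j] [i' j'].
rewrite /bundle_arc /cycle_graph /fiber_next /base_next /=.
rewrite !xpair_eqE (eq_sym i i') andb_orr -orbA; do 2!congr orb.
have -> : (i' == ordS i) = (i' == (if i.+1 < s then i.+1 else 0) :> nat).
  by rewrite -val_ordS.
have := ltn_ord i; have := ltn_ord i'.
case: (ltngtP i.+1 s) => /= [||i_s] i's // _.
- by rewrite orbF.
- by rewrite (_ : (i' == i.+1 :> nat) = false) //; lia.
Qed.

Lemma bundleE u v : bundle phi u v =
  [|| v == fiber_next u, u == fiber_next v,
      v == base_next u | u == base_next v].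
Proof.
rewrite /bundle /= !bundle_arcE.
by do ![case: (_ == _); rewrite ?orbT ?orbF //=].
Qed.

Definition fiber_prev := invF fiber_next_inj.
Definition base_prev := invF base_next_inj.

Lemma fiber_prevK : cancel fiber_prev fiber_next.
Proof. exact: f_invF. Qed.

Lemma base_prevK : cancel base_prev base_next.
Proof. exact: f_invF. Qed.

Lemma bundle_neighbours u :
  bundle phi u =i [:: fiber_next u; fiber_prev u; base_next u; base_prev u].
Proof.
move=> v; rewrite [LHS]bundleE !inE.
rewrite -(inj_eq fiber_next_inj v (fiber_prev u)) fiber_prevK.
by rewrite -(inj_eq base_next_inj v (base_prev u)) base_prevK ![_ == u]eq_sym.
Qed.

Lemma ordS_neq n (i : 'I_n) : 1 < n -> ordS i != i.
Proof.
move=> n1; apply/eqP => /(congr1 (@nat_of_ord n)); rewrite val_ordS.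
by have := ltn_ord i; case: ifP; lia.
Qed.

Lemma ordSS_neq n (i : 'I_n) : 2 < n -> ordS (ordS i) != i.
Proof.
move=> n2; apply/eqP => /(congr1 (@nat_of_ord n)); rewrite !val_ordS.
by have := ltn_ord i; do 2?case: ifP; lia.
Qed.

(** Fiber moves keep the first coordinate and base moves change it; successor and predecessor differ
    because both cycles have length above 2. *)
Lemma bundle_degree u : 2 < s -> 2 < t -> #|bundle phi u| = 4.
Proof.
move=> s3 t3; rewrite (eq_card (bundle_neighbours u)).
have fp1 : (fiber_prev u).1 = u.1 by rewrite -{2}(fiber_prevK u).
have bn1 v : (base_next v).1 != v.1 by apply: ordS_neq; lia.
apply/card_uniqP; rewrite /= !inE !negb_or !andbT.
apply/and3P; split; [apply/and3P; split | apply/andP; split |].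
- apply: contraNneq (ordSS_neq u.2 t3) => /(congr1 fiber_next).
  by rewrite fiber_prevK => /(congr1 snd) /= ->.
- by apply: contraNneq (bn1 u) => <-.
- by apply: contraNneq (bn1 (fiber_next u)) => e; rewrite {1}e base_prevK.
- by apply: contraNneq (bn1 u) => <-; rewrite fp1.
- by apply: contraNneq (bn1 (fiber_prev u)) => e; rewrite {1}e base_prevK fp1.
- apply: contraNneq (ordSS_neq u.1 s3) => /(congr1 base_next).
  by rewrite base_prevK => /(congr1 fst) /= ->.
Qed.

End BundleArcs.

(* Arc [true, i, j] goes along the fiber from (i, j), arc [false, i, j] along
   the base. *)
Definition arc_head (s t d : nat) (b : bool) (i j : nat) : nat * nat :=
  if b then (i, if j.+1 < t then j.+1 else 0)
  else if i.+1 < s then (i.+1, j)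
  else (0, if j + d < t then j + d else j + d - t).

(** * Embeddings given by arithmetic formulas *)

Section Layout.

Variables (s t d m : nat) (key : nat -> nat -> nat * nat).
Variable col : bool -> nat -> nat -> nat.

(** Indices are plain natural numbers and wrapping is a conditional, so that every clause reduces to
    linear arithmetic after case splits. *)
Definition layout : Prop :=
  [/\ d <= t,
      forall i j i' j', i < s -> j < t -> i' < s -> j' < t ->
        key i j = key i' j' -> i = i' /\ j = j',
      forall b i j, i < s -> j < t -> col b i j < m
    & forall b i j b' i' j', i < s -> j < t -> i' < s -> j' < t ->
        col b i j = col b' i' j' -> ~ (b = b' /\ i = i' /\ j = j') ->
        let u := arc_head s t d b i j in let v := arc_head s t d b' i' j' in
        apart (key i j) (key u.1 u.2) (key i' j') (key v.1 v.2)].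

Lemma embeddable_layout : layout -> embeddable (@bundle s t (shift d)) m.
Proof.
move=> [dt key_inj col_lt sep].
pose K (v : 'I_s * 'I_t) := key v.1 v.2.
pose tgt (a : bool * ('I_s * 'I_t)) :=
  if a.1 then fiber_next a.2 else base_next (shift d) a.2.
pose c (a : bool * ('I_s * 'I_t)) :=
  Ordinal (col_lt a.1 _ _ (ltn_ord a.2.1) (ltn_ord a.2.2)).
apply: (@embeddable_of_arcs _ _ _ (fun a => a.2) tgt m K c).
- move=> x y; rewrite bundleE.
  case/or4P => /eqP ->; [exists (true, x) | exists (true, y)
    | exists (false, x) | exists (false, y)] => //.
  1,2: by rewrite setUC.
- move=> [i j] [i' j'] /key_inj[] //= /val_inj -> /val_inj -> //.
- have tgtE a :
      K (tgt a) = let u := arc_head s t d a.1 a.2.1 a.2.2 in key u.1 u.2.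
    case: a => [[] [i j]]; rewrite /K /= modn_succ //; case: ifP => //= _.
    (* Since [d <= t], the sum [j + d] is below twice [t] and wraps at most once. *)
    congr key; have := ltn_ord j; case: (ltnP (j + d) t) => [lt_jd _|le_t lt_j].
      by rewrite modn_small.
    by rewrite -[in LHS](subnK le_t) modnDr modn_small //; lia.
  move=> [b [i j]] [b' [i' j']] /(congr1 val)/= e; rewrite !tgtE /=.
  have [] := altP ((b, (i, j)) =P (b', (i', j'))); first by left.
  move=> ne; right; apply: sep => // -[eb [ei ej]]; case/eqP: ne.
  by move: eb ei ej => /= -> /val_inj -> /val_inj ->.
Qed.

End Layout.

(** * Case analysis on parities and conditionals *)

Lemma parity n : (exists a, n = a.*2) \/ (exists a, n = a.*2.+1).
Proof. by case: (boolP (odd n)) => h; [right | left]; exists n./2; lia. Qed.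

#[local] Arguments double : simpl never.
#[local] Arguments addn : simpl never.
#[local] Arguments odd : simpl never.

Ltac simpl_odd :=
  lazymatch goal with
  | |- context [odd _] =>
    repeat first [rewrite oddD | rewrite oddS | rewrite doubleS
      | rewrite odd_double | rewrite oddB; [|lia]];
    rewrite ?(addbT, addbF, negbK)
  | _ => idtac
  end; rewrite /=.

(** Innermost conditions come first. The parity of a variable is decided by writing it as [a.*2] or
    [a.*2.+1], which stays within linear arithmetic. *)
Ltac split_if b :=
  lazymatch b with context [if _ then _ else _] => fail | _ => idtac end;
  first
  [ match b with context [odd ?x] =>
      is_var x; let a := fresh "a" in case: (parity x) => -[a ?]; subst x end
  | let h := fresh "h" in case: (boolP b) => h ];
  try (exfalso; lia); simpl_odd.

Ltac split_colors :=
  repeat match goal with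
  | |- ?l = ?r -> _ =>
    match constr:((l, r)) with context [if ?b then _ else _] => split_if b end
  end; let e := fresh "e" in move=> e; try discriminate e; clear e.

Ltac split_keys :=
  repeat match goal with |- context [if ?b then _ else _] => split_if b end.

(* Colors are compared before the keys are expanded, so that most pairs of arcs
   are discarded while the goal is small. *)
Ltac prove_layout :=
  split;
  [ lia
  | let i := fresh "i" in let j := fresh "j" in
    let i' := fresh "i'" in let j' := fresh "j'" in
    intros i j i' j' ? ? ? ?; do ?case: ifP => ?; case; lia
  | let b := fresh "b" in intros b ? ? _ _; destruct b; by do ?case: ifP
  | let b := fresh "b" in let i := fresh "i" in let j := fresh "j" in
    let b' := fresh "b'" in let i' := fresh "i'" in let j' := fresh "j'" in
    intros b i j b' i' j' ? ? ? ?; rewrite /arc_head; destruct b, b';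
    abstract (simpl_odd; split_colors; split_keys;
      let ne := fresh "ne" in move=> ne; rewrite /apart /lexlt /lexneq /=;
      repeat (apply/andP; split); lia) ].

(** * Explicit layouts with four and five colors *)

Definition boustrophedon t i j : nat * nat :=
  (i, if odd i then t.-1 - j else j).

(** The twisted edges form two nested families, according to whether [j + d.*2] wraps, with colors 1
    and 2. In the first and last rows the fiber edges from even [j] take the other one of 1 and 2;
    the shift being even, none of them straddles the boundary between the families. *)
Lemma layout4_even s t d : 0 < s -> 1 < t -> 0 < d <= t ->
  layout s.*2 t.*2 d.*2 4 (boustrophedon t.*2)
    (fun b i j =>
      if b then
        if odd j then 3
        else if i == 0 then if j < d.*2 then 1 else 2
        else if i.+1 == s.*2 then if t.*2 - d.*2 <= j then 1 else 2
        else 2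
      else if i.+1 == s.*2 then if j + d.*2 < t.*2 then 1 else 2
      else if odd i then 1 else 0).
Proof. by rewrite /boustrophedon => s0 t1 /andP[d0 dt]; prove_layout. Qed.

(** Even columns stand at increasing places, odd columns reversed at decreasing places. Fiber edges
    from even [j], fiber edges from odd [j], and likewise twisted edges, which change the parity of
    the column, each join columns whose places have a constant sum modulo [t.*2]: such chords are
    parallel. The other base edges join consecutive vertices. *)
Lemma layout4_odd s t d : 2 < s -> 1 < t -> d.*2.+1 <= t.*2 -> odd s ->
  layout s t.*2 d.*2.+1 4
    (fun i j => if odd j then (t.*2 - j, s.-1 - i) else (j, i))
    (fun b i j =>
      if b then if odd j then 1 else 0 else if odd (i + j) then 3 else 2).
Proof. by move=> s2 t1 dt s_odd; prove_layout. Qed.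

(** Color 4 is reserved for the twisted edges that wrap, so all rows share the same coloring of
    their fibers. *)
Lemma layout5_even_even s t d : 0 < s -> 1 < t -> d <= t.*2 ->
  layout s.*2 t.*2 d 5 (boustrophedon t.*2)
    (fun b i j =>
      if b then if odd j then 3 else 2
      else if i.+1 == s.*2 then if j + d < t.*2 then 1 else 4
      else if odd i then 1 else 0).
Proof. by rewrite /boustrophedon => s0 t1 dt; prove_layout. Qed.

(** Each odd fiber needs a third color, and one edge of it takes 4: columns 0 and 1 in the last row,
    the last two columns in row 0. For [d < t.*2] the wrapping twisted edges, also of color 4, avoid
    these vertices. *)
Lemma layout5_even_odd s t d : 0 < s -> 0 < t -> d < t.*2 ->
  layout s.*2 t.*2.+1 d 5 (boustrophedon t.*2.+1)
    (fun b i j =>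
      if b then
        if i == 0 then
          if j.+1 == t.*2 then 4
          else if j == t.*2 then 3 else if odd j then 3 else 2
        else if j == 0 then 4 else if odd j then 2 else 3
      else if i.+1 == s.*2 then if j + d < t.*2.+1 then 1 else 4
      else if odd i then 1 else 0).
Proof. by rewrite /boustrophedon => s0 t0 dt; prove_layout. Qed.

(* When s is odd, rows 0 and 1 are interleaved into a single one, which leaves
   an even number of rows for the boustrophedon order. *)
Lemma layout5_odd_even s t d : 0 < s -> 1 < t -> d <= t.*2 ->
  layout s.*2.+1 t.*2 d 5
    (fun i j =>
      if i < 2 then (0, if odd (i + j) then (j + j).+1 else j + j)
      else (i.-1, if odd i then j else t.*2.-1 - j))
    (fun b i j =>
      if b then if odd j then 3 else 2
      else if i == s.*2 then if j + d < t.*2 then 0 else 4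
      else if i == 0 then if j < d then 0 else 4
      else if odd i then 1 else 0).
Proof. by move=> s0 t1 dt; prove_layout. Qed.

(** Here the later rows come in decreasing order, so that the last row directly follows the
    interleaved pair. Wrapping twisted edges take 3, except 4 for the one into column 0; fiber edges
    at their ends avoid 3 by using 0 in row 0, and 0 and 4 in the last row. As the shift is odd,
    these fiber edges do not straddle the boundary in row 0. *)
Lemma layout5_odd_odd s t d : 0 < s -> 0 < t -> d <= t ->
  layout s.*2.+1 t.*2.+1 d.*2.+1 5
    (fun i j =>
      if i < 2 then
        (0, if (j == 0) || odd j then j + j + i else (j + j).+1 - i)
      else (s.*2.+1 - i, if odd i then j else t.*2 - j))
    (fun b i j =>
      if b then
        if j == t.*2 then 2
        else if i == 0 then
          if j == 0 then 1
          else if odd j then if j < d.*2.+1 then 0 else 3 else 2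
        else if (i == s.*2) && (t.*2 - d.*2 <= j) then if odd j then 4 else 0
        else if j == 0 then 4 else if odd j then 3 else 2
      else if i == s.*2 then
        if j + d.*2.+1 < t.*2.+1 then 0
        else if j + d.*2.+1 == t.*2.+1 then 4 else 3
      else if i == 0 then if j == 0 then 0 else if j == 1 then 2 else 4
      else if i == 1 then if j == 0 then 3 else 1
      else if odd i then 1 else 0).
Proof. by move=> s0 t0 dt; prove_layout. Qed.

(** * Transport of embeddings and reflection of the fiber *)

Lemma embeddable_hom (V : finType) (e e' : rel V) (f : V -> V) m :
  injective f -> {homo f : x y / e x y >-> e' x y} ->
  embeddable e' m -> embeddable e m.
Proof.
move=> f_inj ef /existsP[p /existsP[c /and3P[/injectiveP p_inj prop cr]]].
have imE (E : edge e) : f @: val E \in edges e'.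
  have /imsetP[[x y]] := valP E; rewrite inE /= => xy ->.
  by apply/imsetP; exists (f x, f y); rewrite ?inE /= ?ef // imsetU1 imset_set1.
pose F (E : edge e) : edge e' := Sub (f @: val E) (imE E).
have F_inj : injective F.
  by move=> E E' /(congr1 val)/= /(imset_inj f_inj) /val_inj.
apply/existsP; exists [ffun x => p (f x)].
apply/existsP; exists [ffun E => c (F E)].
apply/and3P; split.
- by apply/injectiveP => x y; rewrite !ffunE => /p_inj/f_inj.
- apply/forallP => E; apply/forallP => E'.
  apply/implyP => /andP[EE' /set0Pn[x]].
  rewrite inE => /andP[xE xE']; rewrite !ffunE.
  have /forallP/(_ (F E'))/implyP := forallP prop (F E); apply.
  rewrite (inj_eq F_inj) EE' /=; apply/set0Pn; exists (f x).
  by rewrite inE !imset_f.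
- apply/forallP => E; apply/forallP => E'; apply/implyP => crE; rewrite !ffunE.
  have /forallP/(_ (F E'))/implyP := forallP cr (F E); apply.
  have alt (A B : {set V}) : alternate [ffun x => p (f x)] A B ->
      alternate p (f @: A) (f @: B).
    case/exists_inP => a aA /exists_inP[b bB].
    case/exists_inP => a' a'A /exists_inP[b' b'B].
    rewrite !ffunE => /and3P[ab ba' ab'].
    by apply: (alternateI _ _ _ _ ab ba' ab'); apply: imset_f.
  by case/orP: crE => /alt h; rewrite /cross h ?orbT.
Qed.

Lemma embeddable_reflect s t d m : d <= t ->
  embeddable (@bundle s t (shift (t - d))) m ->
  embeddable (@bundle s t (shift d)) m.
Proof.
move=> dt; apply: (@embeddable_hom _ _ _ (fun u => (u.1, rev_ord u.2))).
  move=> [i j] [i' j'] /eqP; rewrite xpair_eqE (inj_eq rev_ord_inj) /=.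
  by case/andP=> /eqP-> /eqP->.
have revS (j : 'I_t) : ordS (rev_ord (ordS j)) = rev_ord j.
  apply: val_inj; rewrite [LHS]val_ordS /= modn_succ //.
  by have := ltn_ord j; case: ifP; case: ifP; lia.
(* The reflection reverses fiber arcs but keeps the direction of base arcs. *)
have fib u v : v = fiber_next u ->
    (u.1, rev_ord u.2) = fiber_next (v.1, rev_ord v.2) :> 'I_s * 'I_t.
  by move=> ->; rewrite /fiber_next /= revS.
have bas u v : v = base_next (shift d) u ->
    (v.1, rev_ord v.2) = base_next (shift (t - d)) (u.1, rev_ord u.2)
    :> 'I_s * 'I_t.
  move=> ->; rewrite /base_next /=; congr pair; case: ifP => // _.
  apply: val_inj => /=; have := ltn_ord u.2; move: (nat_of_ord u.2) => j lt_jt.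
  case: (ltnP (j + d) t) => le_t.
    rewrite [in LHS]modn_small //.
    rewrite (_ : t - j.+1 + (t - d) = t - (j + d).+1 + t); last lia.
    by rewrite modnDr modn_small //; lia.
  rewrite -{1}(subnK le_t) modnDr !modn_small; lia.
move=> u v; rewrite !bundleE.
by case/or4P => /eqP; [move/fib | move/fib | move/bas | move/bas] => ->;
  rewrite eqxx ?orbT.
Qed.

(** * Parity conditions for bipartiteness *)

(** Two closed walks have even length: once around a fiber, of length [t], and [s] base steps
    compared with [d] fiber steps, both leading from (0, 0) to (0, [d] mod [t]). *)
Lemma bipartite_bundle_parity s t d : 0 < s -> 0 < t ->
  bipartite (@bundle s t (shift d)) -> ~~ odd t /\ odd s = odd d.
Proof.
case: s => // s _; case: t => // t _ [A Ae].
have fib v : (fiber_next v \in A) = (v \notin A).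
  have := Ae v (fiber_next v); rewrite bundleE eqxx => /(_ isT).
  by case: (v \in A); case: (_ \in A).
have bas v : (base_next (shift d) v \in A) = (v \notin A).
  have := Ae v (base_next (shift d) v); rewrite bundleE eqxx !orbT => /(_ isT).
  by case: (v \in A); case: (_ \in A).
have row n i : ((i, shift n ord0) \in A) = odd n (+) ((i, ord0) \in A).
  elim: n => [|n IHn]; first by congr ((_, _) \in A); apply: val_inj.
  have -> : (i, shift n.+1 ord0) = fiber_next (i, shift n ord0)
      :> 'I_s.+1 * 'I_t.+1.
    congr pair; apply: val_inj.
    by rewrite /= !add0n -[n.+1]addn1 -modnDml addn1.
  by rewrite fib IHn /= addNb.
have col n : n <= s ->
    ((inord n, ord0) \in A) = odd n (+) ((ord0, ord0) \in A).
  elim: n => [|n IHn] ns.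
    by congr ((_, _) \in A); apply: val_inj; rewrite /= inordK.
  have -> : (inord n.+1, ord0) = base_next (shift d) (inord n, ord0)
      :> 'I_s.+1 * 'I_t.+1.
    rewrite /base_next /= inordK; last by lia.
    rewrite ltnS ns; congr pair; apply: val_inj.
    by rewrite /= !inordK ?modn_small //; lia.
  by rewrite bas IHn ?addNb //; lia.
split.
  have := row t.+1 ord0; have -> : shift t.+1 (@ord0 t) = ord0.
    by apply: val_inj; rewrite /= add0n modnn.
  by case: (odd t.+1); case: (_ \in A).
have := bas (inord s, ord0); rewrite col //.
have -> : base_next (shift d) (inord s, ord0) = (ord0, shift d ord0)
    :> 'I_s.+1 * 'I_t.+1.
  rewrite /base_next /= inordK // ltnn; congr pair; apply: val_inj.
  by rewrite /= inordK // modnn.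
by rewrite row oddS; case: (odd s); case: (odd d); case: (_ \in A).
Qed.

(** * Assembly of the bounds *)

Lemma embeddable5_bundle s t d : 2 < s -> 2 < t -> d <= t ->
  embeddable (@bundle s t (shift d)) 5.
Proof.
have [[a ->]|[a ->]] := parity s;
  have [[b ->]|[b ->]] := parity t => s3 t3 dt.
- by apply/embeddable_layout/layout5_even_even; lia.
(* The remaining shifts [b.*2] and [b.*2.+1] are reflected to 1 and 0. *)
- have [dt'|dt'] := ltnP d b.*2.
    by apply/embeddable_layout/layout5_even_odd; lia.
  apply: embeddable_reflect => //.
  by apply/embeddable_layout/layout5_even_odd; lia.
- by apply/embeddable_layout/layout5_odd_even; lia.
- move: dt; have [[c ->]|[c ->]] := parity d => dt; last first.
    by apply/embeddable_layout/layout5_odd_odd; lia.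
  (* With [t] odd, reflection turns the even shift into an odd one. *)
  apply: embeddable_reflect => //.
  rewrite (_ : _ - _ = (b - c).*2.+1); last lia.
  by apply/embeddable_layout/layout5_odd_odd; lia.
Qed.

Lemma embeddable4_bundle s t d :
  2 < s -> 2 < t -> 0 < d <= t -> ~~ odd t -> odd s = odd d ->
  embeddable (@bundle s t (shift d)) 4.
Proof.
have [[b ->]|[b ->]] := parity t; last by rewrite oddS odd_double.
have [[c ->]|[c ->]] := parity d; have [[a ->]|[a ->]] := parity s;
  rewrite ?oddS ?odd_double // => *; apply: embeddable_layout.
- by apply: layout4_even; lia.
- by apply: layout4_odd; rewrite ?oddS ?odd_double; lia.
Qed.

Lemma mbt_eq (V : finType) (e : rel V) m :
  embeddable e m -> (forall k, embeddable e k -> m <= k) -> mbt e = m.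
Proof.
move=> em lb; rewrite /mbt; case: ex_minnP => k ek kmin.
by apply/eqP; rewrite eqn_leq kmin // lb.
Qed.

Theorem theorem3p1 (s t d : nat) (hs : 3 <= s) (ht : 3 <= t)
    (hd : 1 <= d <= t) :
  let G := @bundle s t (@shift t d) in
  (bipartite G -> mbt G = 4) /\ (~ bipartite G -> mbt G = 5).
Proof.
move=> G; have G_irr : irreflexive G by apply: bundle_irrefl; lia.
have G_reg v : #|G v| = 4 by apply: (bundle_degree (@shift_inj t d)).
have v0 : 'I_s * 'I_t by split; [exists 0 | exists 0]; lia.
have lb k : embeddable G k -> 4 <= k.
  case/existsP => p /existsP[c emb].
  by rewrite -(G_reg v0) (degree_le G_irr emb).
split=> [bip | nbip]; apply: mbt_eq.
- have [||t_even sd] := bipartite_bundle_parity _ _ bip; [lia..|].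
  exact: embeddable4_bundle.
- exact: lb.
- by apply: embeddable5_bundle => //; case/andP: hd.
- move=> k Gk; rewrite ltn_neqAle lb // andbT; apply/eqP => k4; apply: nbip.
  move: Gk; rewrite -k4 => /existsP[p /existsP[c emb]].
  exact: (perfect_bipartite (@bundle_sym s t _) G_irr emb G_reg).
Qed.
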